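(* Let $F:\mathbb{N}\times\mathbb{R}\to\mathbb{R}$ satisfy $F(n,\cdot)\in C^1(\mathbb{R},\mathbb{R})$ for any $n\in\mathbb{N}$. Let $(u_n)_{n\in\mathbb{N}}$ be a sequence of non-negative numbers satisfying $u_{n+1}-u_n\le F(n,u_n)$ for all $n\in\mathbb{N}$. Assume that there exist $n_0\in\mathbb{N}$ and $A_1>0$ such that for all $n\ge n_0$ and all $x\ge A_1$, $F(n,x)<0$. In addition, assume that there exists $A_2>0$ such that for all $n\ge n_0$ and all $x\ge0$, $F(n,x)\le A_2$. Then there exists $B>0$ such that $u_n\le B$ for all $n\in\mathbb{N}$, with $$B=\max\Big(\max_{n\le n_0+1}u_n,\,A_1\Big)+A_2 .$$
   Context: $\mathbb{N}=\{0,1,2,\dots\}$. *)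

(* Defs.v *)
From mathcomp Require Import all_boot all_order all_algebra.
From mathcomp Require Import all_classical all_reals all_analysis.

Set Implicit Arguments.
Unset Strict Implicit.
Unset Printing Implicit Defensive.

Import Order.TTheory GRing.Theory Num.Theory.
Import numFieldNormedType.Exports.

Local Open Scope ring_scope.
Local Open Scope classical_set_scope.

(* `f^`()` is a total operator, so differentiability is a separate clause. *)
Definition C1 (R : realType) (f : R -> R) : Prop :=
  (forall x : R, derivable f x 1) /\ continuous (f^`() : R -> R).

(* Main.v *)
Require Import Defs.
From mathcomp Require Import all_boot all_order all_algebra.
From mathcomp Require Import all_classical all_reals all_analysis.

Import Order.TTheory GRing.Theory Num.Theory.
Import numFieldNormedType.Exports.

(** Past time [n0] the bound [B] is invariant under one step. A value below [A1]
    rises by at most [A2], hence stays below [A1 + A2 <= B]; a value of at least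
    [A1] strictly decreases, hence stays below any bound it already satisfies.
    Up to time [n0] the maximum in [B] dominates the sequence directly, so the
    invariance starts from a bounded value. *)

Local Open Scope ring_scope.

Theorem lemma4 (R : realType) (F : nat -> R -> R) (u : nat -> R)
    (n0 : nat) (A1 A2 : R)
    (F_C1 : forall n : nat, C1 (F n))
    (u_ge0 : forall n : nat, 0 <= u n)
    (u_step : forall n : nat, u n.+1 - u n <= F n (u n))
    (A1_gt0 : 0 < A1)
    (F_lt0 : forall (n : nat) (x : R), (n0 <= n)%N -> A1 <= x -> F n x < 0)
    (A2_gt0 : 0 < A2)
    (F_leA2 : forall (n : nat) (x : R), (n0 <= n)%N -> 0 <= x -> F n x <= A2) :
  exists B : R,
    [/\ 0 < B,
        B = Num.max (\big[Num.max/u 0%N]_(n < n0.+2) u n) A1 + A2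
      & forall n : nat, u n <= B].
Proof.
set M := Num.max _ A1.
have A1_le_M : A1 <= M by rewrite le_max lexx orbT.
exists (M + A2); split=> //.
  by rewrite addr_gt0 // (lt_le_trans A1_gt0).
elim=> [|n IHn].
  apply: ler_wpDr; first exact: ltW.
  by rewrite le_max bigmax_ge_id.
have [n0_le_n | n_lt_n0] := leqP n0 n; last first.
  have n1_lt : (n.+1 < n0.+2)%N by rewrite ltnS (leq_trans n_lt_n0).
  apply: ler_wpDr; first exact: ltW.
  rewrite le_max.
  by rewrite (le_bigmax (u 0%N) (fun i : 'I_n0.+2 => u i) (Ordinal n1_lt)).
have un1_le : u n.+1 <= F n (u n) + u n by rewrite -lerBlDr.
apply: (le_trans un1_le).
have [A1_le_un | un_lt_A1] := leP A1 (u n).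
  by rewrite -[leRHS]add0r lerD // ltW // F_lt0.
by rewrite addrC lerD ?F_leA2 // (le_trans (ltW un_lt_A1)).
Qed.
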